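(* Let $K$ be a compact metric space, let $(f_n)$ be a weakly null sequence in $C(K)$, let $\epsilon>0$ and let $\alpha$ be a countable ordinal. (i) If $o(S,\epsilon)\ge\alpha$, then $\mathcal O(\epsilon')\ge\alpha$ for every $0<\epsilon'<\epsilon$. (ii) If $\mathcal O(\epsilon)\ge\omega^{1+\alpha}$, then $o(S,\epsilon)\ge\omega^\alpha$.
   Context: **Oscillation index.** For $\epsilon>0$ put $A^+_{n,m}=\{k\in K: f_n(k)-f_m(k)>\epsilon\}$ and $A^-_{n,m}=\{k\in K: f_n(k)-f_m(k)<-\epsilon\}$. Let $\mathcal O^0(\epsilon,(f_n),K)=K$. Let $\mathcal O^{\alpha+1}(\epsilon,(f_n),K)$ be the set of $k\in\mathcal O^{\alpha}(\epsilon,(f_n),K)$ such that for every neighborhood $\mathcal N$ of $k$ there is $N\in\mathbb N$ such that for all $n\ge N$ there is $M\in\mathbb N$ with $\bigcap_{m\ge M}A^+_{n,m}\cap\mathcal O^\alpha(\epsilon,(f_n),K)\cap\mathcal N\ne\emptyset$ or $\bigcap_{m\ge M}A^-_{n,m}\cap\mathcal O^\alpha(\epsilon,(f_n),K)\cap\mathcal N\ne\emptyset$. For limit $\beta$, $\mathcal O^\beta=\bigcap_{\alpha<\beta}\mathcal O^\alpha$. $\mathcal O(\epsilon)=\mathcal O(\epsilon,(f_n),K)$ is the largest ordinal $\alpha$ with $\mathcal O^\alpha(\epsilon,(f_n),K)\ne\emptyset$. **Spreading model index.** For a sequence $(e_i)$ of bounded functions (sup norm), $$\ell^1\text{-}SP((e_i))=\lim_k\lim_m\inf\Big\{k^{-1}\Big\|\sum_{i=1}^ke_{n_i}\Big\|:m\le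 n_1<n_2<\dots<n_k\Big\}.$$ Let $S^0(\epsilon,(f_n),K)=K$; $S^{\alpha+1}(\epsilon,(f_n),K)$ is the set of $x\in S^\alpha(\epsilon,(f_n),K)$ such that for every neighborhood $\mathcal N$ of $x$ relative to $S^\alpha(\epsilon,(f_n),K)$ and every infinite $M\subset\mathbb N$ there is an infinite $L\subset M$ with $\ell^1\text{-}SP((f_n|_{\mathcal N})_{n\in L})\ge\epsilon$; for limit $\alpha$, $S^\alpha=\bigcap_{\beta<\alpha}S^\beta$. $o(S,\epsilon)$ is the largest ordinal $\alpha$ with $S^\alpha(\epsilon,(f_n),K)\ne\emptyset$. *)

(* Defs.v *)
From HB Require Import structures.
From mathcomp Require Import all_boot all_order all_algebra.
From mathcomp Require Import all_classical all_reals all_analysis.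

Set Implicit Arguments.
Unset Strict Implicit.
Unset Printing Implicit Defensive.

Import Order.TTheory GRing.Theory Num.Theory.
Import numFieldNormedType.Exports.

Local Open Scope classical_set_scope.
Local Open Scope ring_scope.

(* Ordinals are well-founded trees: [Osup f] stands for the least ordinal     *)
(* strictly above all the [f i]. A tree is a representative of an ordinal,    *)
(* and two trees represent the same ordinal when [oeq] holds.                 *)
Inductive ord : Type := Osup (X : Type) (f : X -> ord).

HB.instance Definition _ := gen_eqMixin ord.
HB.instance Definition _ := gen_choiceMixin ord.

Fixpoint ole (a b : ord) : Prop :=
  match a, b with
  | Osup X f, Osup Y g => forall x : X, exists y : Y, ole (f x) (g y)
  end.

Definition olt (a b : ord) : Prop :=
  let: Osup Y g := b in exists y : Y, ole a (g y).

Definition oeq (a b : ord) : Prop := ole a b /\ ole b a.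

Definition ozero : ord := Osup (fun x : Empty_set => match x with end).

Definition osucc (a : ord) : ord := Osup (fun _ : unit => a).

Definition olimit (a : ord) : Prop :=
  olt ozero a /\ forall b, olt b a -> olt (osucc b) a.

Definition ocountable (a : ord) : Prop :=
  exists e : nat -> ord, forall b, olt b a -> exists n, oeq b (e n).

Definition obranches (a : ord) : Type := let: Osup X _ := a in X.

Definition obranch (a : ord) : obranches a -> ord :=
  match a with Osup X f => f end.

(* The least ordinal above all the [g x], not necessarily strictly.           *)
Definition osupremum (X : Type) (g : X -> ord) : ord :=
  Osup (fun p : {x : X & obranches (g x)} => obranch (projT2 p)).

Definition oone : ord := osucc ozero.

Definition oomega : ord := Osup (fun n : nat => iter n osucc ozero).

(* a + b = sup ({a} \cup {(a + c) + 1 : c < b}). For each of the three        *)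
(* operations the clauses at 0, at successors and at limits are proved below. *)
Fixpoint oadd (a b : ord) : ord :=
  let: Osup X f := b in
  osupremum (fun o : option X =>
    if o is Some x then osucc (oadd a (f x)) else a).

(* a * b = sup {a * c + a : c < b}                                            *)
Fixpoint omul (a b : ord) : ord :=
  let: Osup X f := b in osupremum (fun x : X => oadd (omul a (f x)) a).

(* omega ^ a = sup ({1} \cup {omega ^ c * omega : c < a})                     *)
Fixpoint oomega_exp (a : ord) : ord :=
  let: Osup X f := a in
  osupremum (fun o : option X =>
    if o is Some x then omul (oomega_exp (f x)) oomega else oone).

Definition is_largest (P : set ord) (a : ord) : Prop :=
  P a /\ forall b, P b -> ole b a.

(* The largest ordinal in [P]; [ozero] if there is none.                      *)
Definition olargest (P : set ord) : ord := xget ozero (is_largest P).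

(* The transfinite iteration A^0 = T, A^(a+1) = D (A^a) and                   *)
(* A^l = \bigcap_(a < l) A^a for l a limit, written with the single formula   *)
(* A^a = \bigcap_(c < a) D (A^c). When [D A `<=` A] for all A, the lemmas     *)
(* [derived0], [derivedS] and [derived_limit] give the three clauses, and     *)
(* [derived_oeq] says that A^a depends only on the ordinal represented by a.  *)
Fixpoint derived (T : Type) (D : set T -> set T) (a : ord) : set T :=
  let: Osup X f := a in [set t | forall x : X, D (derived D (f x)) t].

Lemma ole_refl a : ole a a.
Proof. by elim: a => X f IH x; exists x; exact: IH. Qed.

Lemma ole_trans b a c : ole a b -> ole b c -> ole a c.
Proof.
elim: a b c => X f IH [Y g] [Z h] /= ab bc x.
have [y fg] := ab x; have [z gh] := bc y.
by exists z; exact: IH fg gh.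
Qed.

Lemma olt_ole_trans a b c : olt a b -> ole b c -> olt a c.
Proof.
case: b c => Y g [Z h] /= [y ay] bc; have [z gz] := bc y.
by exists z; exact: ole_trans gz.
Qed.

Lemma ole_olt_trans a b c : ole a b -> olt b c -> olt a c.
Proof. by case: c => Z h ab [z bz]; exists z; exact: ole_trans bz. Qed.

Lemma olt_branch (X : Type) (f : X -> ord) (x : X) : olt (f x) (Osup f).
Proof. by exists x; exact: ole_refl. Qed.

Lemma oltW a b : olt a b -> ole a b.
Proof.
elim: a b => X f IH [Y g] [y /= fy] x; exists y.
exact/IH/(olt_ole_trans (olt_branch f x)).
Qed.

Lemma ole_succ a b : ole (osucc a) b <-> olt a b.
Proof. by case: b => Y g; split=> [/(_ tt)|aj []]. Qed.

Lemma olt_succ a b : olt a (osucc b) <-> ole a b.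
Proof. by split=> [[[]]|ab]; [|exists tt]. Qed.

Lemma ole0 a : ole ozero a.
Proof. by case: a => X f x; case: x. Qed.

Lemma ole_olt (X : Type) (f : X -> ord) b :
  ole (Osup f) b <-> forall x, olt (f x) b.
Proof. by case: b => Y g. Qed.

Lemma ole_obranch a b :
  (forall x : obranches a, olt (obranch x) b) -> ole a b.
Proof. by case: a => X f /= ab; exact/ole_olt. Qed.

Lemma olt_obranch a (x : obranches a) : olt (obranch x) a.
Proof. by case: a x => X f x; exact: olt_branch. Qed.

Lemma ole_or_olt a b : ole a b \/ olt b a.
Proof.
elim: a b => X f IH b.
have [|/existsNP[x fxb]] := pselect (forall x, olt (f x) b).
  by move=> /ole_olt; left.
right; exists x; case: b fxb => Y g fxb; apply/ole_olt => y.
by have [fxg|//] := IH x (g y); case: fxb; exists y.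
Qed.

Lemma olt_wf : well_founded olt.
Proof.
suff acc a b : ole b a -> Acc olt b by move=> a; exact: acc (ole_refl a).
elim: a b => X f IH b ba; constructor => c cb.
by have [x cx] := olt_ole_trans cb ba; exact: IH cx.
Qed.

Lemma osupremum_le (X : Type) (g : X -> ord) b :
  ole (osupremum g) b <-> forall x, ole (g x) b.
Proof.
split=> [/ole_olt gb x|gb].
  by apply: ole_obranch => y; exact: (gb (existT _ x y)).
apply/ole_olt => -[x y]; apply: olt_ole_trans (gb x).
exact: olt_obranch.
Qed.

Lemma le_osupremum (X : Type) (g : X -> ord) x : ole (g x) (osupremum g).
Proof. by move: x; apply/osupremum_le; exact: ole_refl. Qed.

Section Derived.
Variables (T : Type) (D : set T -> set T).
Hypothesis D_sub : forall A, D A `<=` A.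

Lemma derived_anti a b : ole a b -> derived D b `<=` derived D a.
Proof.
elim/(well_founded_ind olt_wf): b a => b IH [X f] ab t tb x /=.
case: b => Y g in IH ab tb *; have [y fy] := ab x.
have gb : olt (g y) (Osup g) by exact: olt_branch.
have [gf|fg] := ole_or_olt (g y) (f x).
  have fgE : derived D (f x) = derived D (g y).
    apply/seteqP; split; last exact: IH.
    by apply: IH gf; exact: ole_olt_trans gb.
  by have := tb y; rewrite -[X in D X]fgE.
have : derived D (osucc (f x)) t.
  by apply: (IH _ gb) (D_sub (tb y)); exact/ole_succ.
exact.
Qed.

Lemma derived_oeq a b : oeq a b -> derived D a = derived D b.
Proof. by move=> [ab ba]; apply/seteqP; split; exact: derived_anti. Qed.

Lemma derived0 : derived D ozero = setT.
Proof. by apply/seteqP; split=> // t _ []. Qed.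

Lemma derivedS a : derived D (osucc a) = D (derived D a).
Proof. by apply/seteqP; split=> [t /(_ tt)//|t ta []]. Qed.

Lemma derived_limit a : olimit a ->
  derived D a = \bigcap_(b in [set b | olt b a]) derived D b.
Proof.
move=> [_ la]; apply/seteqP; split=> [t ta b /oltW ba|t].
  exact: derived_anti ba _ ta.
case: a la => X f la ta x.
by have := ta _ (la _ (olt_branch f x)); rewrite derivedS.
Qed.

End Derived.

Lemma oadd_le2 a a' b b' : ole a a' -> ole b b' -> ole (oadd a b) (oadd a' b').
Proof.
move=> aa'; elim: b b' => X f IH [Y g] bb'; apply/osupremum_le => -[x|].
  have [y fg] := bb' x; apply: ole_trans (le_osupremum _ (Some y)).
  by apply/ole_succ/olt_succ/IH.
exact: ole_trans (le_osupremum _ None).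
Qed.

Lemma oadd0 a : oeq (oadd a ozero) a.
Proof.
split; last exact: (le_osupremum _ None).
by apply/osupremum_le => -[[]|]; exact: ole_refl.
Qed.

Lemma ole_oadd a b : ole a (oadd a b).
Proof. by case: b => X f; exact: (le_osupremum _ None). Qed.

Lemma oaddS a b : oeq (oadd a (osucc b)) (osucc (oadd a b)).
Proof.
split; last exact: (le_osupremum _ (Some tt)).
apply/osupremum_le => -[_|]; first exact: ole_refl.
by apply/oltW/olt_succ/ole_oadd.
Qed.

Lemma oadd_limit a b c : olimit b ->
  ole (oadd a b) c <-> forall d, olt d b -> ole (oadd a d) c.
Proof.
move=> [b0 lb]; split=> [abc d /oltW db|].
  by apply: ole_trans abc; apply: oadd_le2 db; exact: ole_refl.
case: b b0 lb => X f b0 lb bc; apply/osupremum_le => -[x|].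
  by apply: ole_trans (bc _ (lb _ (olt_branch f x))); case: (oaddS a (f x)).
by apply: ole_trans (bc _ b0); exact: ole_oadd.
Qed.

Lemma omul_le2 a a' b b' : ole a a' -> ole b b' -> ole (omul a b) (omul a' b').
Proof.
move=> aa'; elim: b b' => X f IH [Y g] bb'; apply/osupremum_le => x.
have [y fg] := bb' x; apply: ole_trans (le_osupremum _ y).
by apply: oadd_le2 => //; exact: IH.
Qed.

Lemma omul0 a : oeq (omul a ozero) ozero.
Proof. by split; [apply/osupremum_le => -[]|exact: ole0]. Qed.

Lemma omulS a b : oeq (omul a (osucc b)) (oadd (omul a b) a).
Proof.
split; last exact: (le_osupremum _ tt).
by apply/osupremum_le => _; exact: ole_refl.
Qed.

Lemma omul_limit a b c : olimit b ->
  ole (omul a b) c <-> forall d, olt d b -> ole (omul a d) c.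
Proof.
move=> [b0 lb]; split=> [abc d /oltW db|].
  by apply: ole_trans abc; apply: omul_le2 db; exact: ole_refl.
case: b b0 lb => X f b0 lb bc; apply/osupremum_le => x.
by apply: ole_trans (bc _ (lb _ (olt_branch f x))); case: (omulS a (f x)).
Qed.

Lemma oomega_exp_le2 a b : ole a b -> ole (oomega_exp a) (oomega_exp b).
Proof.
elim: a b => X f IH [Y g] ab; apply/osupremum_le => -[x|].
  have [y fg] := ab x; apply: ole_trans (le_osupremum _ (Some y)).
  by apply: omul_le2 (ole_refl _); exact: IH.
exact: (le_osupremum _ None).
Qed.

Lemma oomega_exp_ge1 a : ole oone (oomega_exp a).
Proof. by case: a => X f; exact: (le_osupremum _ None). Qed.

Lemma oomega_exp0 : oeq (oomega_exp ozero) oone.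
Proof.
split; last exact: oomega_exp_ge1.
by apply/osupremum_le => -[[]|]; exact: ole_refl.
Qed.

Lemma oomega_expS a :
  oeq (oomega_exp (osucc a)) (omul (oomega_exp a) oomega).
Proof.
split; last exact: (le_osupremum _ (Some tt)).
apply/osupremum_le => -[_|]; first exact: ole_refl.
apply: ole_trans (le_osupremum _ 1%N).
apply: ole_trans (oadd_le2 (ole0 _) (oomega_exp_ge1 a)).
by case: (oaddS ozero ozero) => _; apply: ole_trans; apply/ole_succ/olt_succ/ole0.
Qed.

Lemma oomega_exp_limit b c : olimit b ->
  ole (oomega_exp b) c <-> forall d, olt d b -> ole (oomega_exp d) c.
Proof.
move=> [b0 lb]; split=> [bc d /oltW /oomega_exp_le2 db|].
  exact: ole_trans db bc.
case: b b0 lb => X f b0 lb bc; apply/osupremum_le => -[x|].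
  by apply: ole_trans (bc _ (lb _ (olt_branch f x))); case: (oomega_expS (f x)).
by apply: ole_trans (bc _ b0); exact: oomega_exp_ge1.
Qed.

Lemma olimit_omega : olimit oomega.
Proof.
split=> [|b [n bn]]; first exact: (olt_branch _ 0%N).
by exists n.+1; exact/ole_succ/olt_succ.
Qed.

(* [sup set0 = 0], so this is the norm of C(K) even for empty K. It is only   *)
(* used for functions that are bounded on A.                                  *)
Definition supnorm (R : realType) (T : Type) (A : set T) (g : T -> R) : R :=
  sup [set `|g t| | t in A].

(* The spreading model quantity of the sequence of the restrictions e_i|_A;   *)
(* n : 'I_k -> nat stands for m <= n_1 < ... < n_k.                           *)
Definition l1SP (R : realType) (T : Type) (A : set T) (e : nat -> T -> R) : R :=
  limn (fun k : nat => limn (fun m : nat =>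
    inf [set k%:R^-1 * supnorm A (fun t => \sum_(i < k) e (n i) t)
        | n in [set n : 'I_k -> nat | (forall i, m <= n i)%N /\
                                      {homo n : i j / (i < j)%N}]])).

Section Indices.
Context {R : realType} {K : metricType R}.

(* C(K) is [continuousType K R] with the norm [supnorm setT]; the library has *)
(* no vector space structure on it, so linearity is stated pointwise.         *)
Definition bounded_functional (phi : continuousType K R -> R) : Prop :=
  (forall (c : R) (g h u : continuousType K R),
     (forall t, u t = c * g t + h t) -> phi u = c * phi g + phi h) /\
  exists C : R, forall g, `|phi g| <= C * supnorm setT g.

Definition weakly_null (f : nat -> continuousType K R) : Prop :=
  forall phi, bounded_functional phi -> (fun n => phi (f n)) @ \oo --> (0 : R).

Variable f : nat -> continuousType K R.
Variable eps : R.

Definition Aplus (n m : nat) : set K := [set k | f n k - f m k > eps].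

Definition Aminus (n m : nat) : set K := [set k | f n k - f m k < - eps].

Definition osc_derivative (A : set K) : set K :=
  [set k | A k /\ forall U, nbhs k U ->
    exists N : nat, forall n, (N <= n)%N -> exists M : nat,
      (\bigcap_(m in [set m | (M <= m)%N]) Aplus n m) `&` A `&` U !=set0 \/
      (\bigcap_(m in [set m | (M <= m)%N]) Aminus n m) `&` A `&` U !=set0].

Lemma osc_derivative_sub A : osc_derivative A `<=` A.
Proof. by move=> k []. Qed.

Definition osc_set (a : ord) : set K := derived osc_derivative a.

Definition osc_index : ord := olargest [set a | osc_set a !=set0].

(* The neighborhoods of x relative to A are the sets U `&` A, and an infinite *)
(* subset L of M is given by its increasing enumeration l.                    *)
Definition SP_derivative (A : set K) : set K :=
  [set x | A x /\ forall U, nbhs x U ->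
    forall M : set nat, infinite_set M ->
      exists l : nat -> nat, [/\ {homo l : i j / (i < j)%N}, range l `<=` M &
        eps <= l1SP (U `&` A) (fun i => f (l i))]].

Lemma SP_derivative_sub A : SP_derivative A `<=` A.
Proof. by move=> k []. Qed.

Definition SP_set (a : ord) : set K := derived SP_derivative a.

Definition SP_index : ord := olargest [set a | SP_set a !=set0].

End Indices.

(* Main.v *)
Require Import Defs.
From HB Require Import structures.
From mathcomp Require Import all_boot all_order all_algebra.
From mathcomp Require Import all_classical all_reals all_analysis.
From mathcomp Require Import lra.

Set Implicit Arguments.
Unset Strict Implicit.
Unset Printing Implicit Defensive.

Import Order.TTheory GRing.Theory Num.Theory.
Import numFieldNormedType.Exports.

Local Open Scope classical_set_scope.
Local Open Scope ring_scope.

(** Since (f_n) tends to 0 pointwise, the oscillation step for eps essentially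
    keeps a point x of A when, in every neighborhood of x and for all large n, A
    has a point where |f_n| >= eps. The theorem compares this step with the
    spreading model step, and then iterates.

    (i) If |f_n| <= eps' on a neighborhood of x in A for infinitely many n, then
    the averages of these f_n are at most eps' in norm there, so x is removed by
    the spreading model step for every eps > eps'. Hence the spreading model step
    for eps is contained in the oscillation step for eps'
    ([SP_derivative_osc]), and so are the iterates.

    (ii) If x survives all finite numbers of oscillation steps applied to a closed
    set A, then x survives one spreading model step applied to A
    ([osc_omega_SP_derivative]). Hence the oscillation set of order
    omega * omega ^ a <= omega ^ (1 + a) is contained in the spreading model set
    of order omega ^ a. To see the claim, let x survive k steps. Moving
    successively to nearby points with one order less gives, for suitable
    n_1 < ... < n_k, a point where all |f_(n_i)| are almost >= eps. The danger is
    that the signs of the f_(n_i) differ and the sum cancels. Here the freedom to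
    pass to a subsequence of M is used: fix an ultrafilter F on the natural
    numbers containing M and all the tails, and consider the two one-signed
    derivations in which the condition is asked of F-almost all n. At each point
    one of the signs prevails, and by induction the derivative of order i + j is
    contained in the union of the positive one of order i and the negative one of
    order j ([iter_osc_derivative_sign]). So for one sign, x has all finite
    one-signed orders. A diagonal choice along F ([diagonal_subsequence]) then
    gives a sequence in M such that for all its k-tuples beyond the k-th term
    there is a point near x where all the terms have that sign and almost the size
    eps. The norms of their averages are therefore almost >= eps.

    The spreading model quantity is an iterated limit. The inner limit is that of
    a monotone sequence, which is bounded because weakly null sequences are
    bounded ([weakly_null_bounded]), and the outer one exists by subadditivity
    ([fekete]).

    Finally, a largest ordinal with a nonempty derivative exists
    ([derived_largest]): derivatives are closed, no nonempty closed set is fixed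
    by a derivation, as pointwise convergence to 0 and compactness show
    ([osc_derivative_strict]), and a strictly decreasing family of closed sets in
    a second countable space is countable. *)

(** * Ordinal arithmetic *)

Lemma olt_irr a : ~ olt a a.
Proof.
by elim/(well_founded_ind olt_wf): a => a IH /[dup] aa; exact: IH.
Qed.

Lemma oadd_assoc a b c : ole (oadd (oadd a b) c) (oadd a (oadd b c)).
Proof.
elim: c => X f IH; apply/osupremum_le => -[x|]; last first.
  exact: oadd_le2 (ole_refl _) (ole_oadd _ _).
apply: (ole_trans _ (oadd_le2 (ole_refl a) (le_osupremum _ (Some x)))).
apply: (ole_trans _ (oaddS _ _).2).
exact/ole_succ/olt_succ/IH.
Qed.

Lemma omul_osupremum a (X : Type) (g : X -> ord) c :
  (forall x, ole (omul a (g x)) c) -> ole (omul a (osupremum g)) c.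
Proof.
move=> gc; apply/osupremum_le => -[x y]; apply: ole_trans (gc x) => /=.
by case: (g x) y => Y h y; exact: (le_osupremum _ y).
Qed.

Lemma omul_oadd a b c : ole (omul a (oadd b c)) (oadd (omul a b) (omul a c)).
Proof.
elim: c => X f IH; apply: omul_osupremum => -[x|]; last exact: ole_oadd.
apply: ole_trans (omulS _ _).1 _.
apply: ole_trans (oadd_le2 (IH x) (ole_refl a)) _.
apply: ole_trans (oadd_assoc _ _ _) _.
exact/oadd_le2/le_osupremum/ole_refl.
Qed.

Lemma omul_assoc a b c : ole (omul a (omul b c)) (omul (omul a b) c).
Proof.
elim: c => X f IH; apply: omul_osupremum => x.
apply: ole_trans (omul_oadd _ _ _) _.
apply: ole_trans (oadd_le2 (IH x) (ole_refl _)) _.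
exact: (le_osupremum _ x).
Qed.

Lemma oadd0l b : ole (oadd ozero b) b.
Proof.
elim: b => X f IH; apply/osupremum_le => -[x|]; last exact: ole0.
by apply/ole_succ/(ole_olt_trans (IH x))/olt_branch.
Qed.

Lemma omul1l b : ole b (omul oone b).
Proof.
elim: b => X f IH; apply/ole_olt => x.
apply: olt_ole_trans (le_osupremum _ x).
apply: olt_ole_trans (oaddS _ _).2.
exact/olt_succ/(ole_trans (IH x))/ole_oadd.
Qed.

(** Both sides satisfy the same recursion in [a]: their value is omega at
    0, and they get multiplied by omega on the right when [a] increases by 1. *)
Lemma omul_omega_exp a :
  ole (omul oomega (oomega_exp a)) (oomega_exp (oadd oone a)).
Proof.
elim: a => X f IH; apply: omul_osupremum => -[x|]; last first.
  apply: ole_trans (omulS _ _).1 _.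
  apply: ole_trans (oadd_le2 (omul0 _).1 (ole_refl _)) _.
  apply: ole_trans (oadd0l _) _.
  apply: ole_trans (omul1l _) _.
  apply: ole_trans (omul_le2 oomega_exp0.2 (ole_refl _)) _.
  apply: ole_trans (oomega_expS _).2 _.
  exact/oomega_exp_le2/ole_oadd.
apply: ole_trans (omul_assoc _ _ _) _.
apply: ole_trans (omul_le2 (IH x) (ole_refl _)) _.
apply: ole_trans (oomega_expS _).2 _.
exact/oomega_exp_le2/(le_osupremum _ (Some x)).
Qed.

Lemma iter_osucc_le_omega a n : ole (iter n osucc a) (oadd a oomega).
Proof.
have: ole (iter n osucc a) (oadd a (iter n osucc ozero)).
  elim: n => [|n IH]; first exact: (oadd0 a).2.
  exact: ole_trans ((ole_succ _ _).2 ((olt_succ _ _).2 IH)) (oaddS _ _).2.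
move=> /ole_trans; apply; apply: oadd_le2 (ole_refl a) _.
exact/oltW/(olt_branch _ n).
Qed.

(** * Derivatives of a second countable compact space *)

Lemma compact_bigcap_chain (T : topologicalType) (X : Type) (A : X -> set T) :
  compact [set: T] -> inhabited X -> (forall x, closed (A x)) ->
  (forall x, A x !=set0) ->
  (forall x y, A x `<=` A y \/ A y `<=` A x) ->
  exists t, forall x, A x t.
Proof.
move=> cT [x0] Acl A0 Achain.
pose F := filter_from [set: X] A.
have FF : ProperFilter F.
  apply: filter_from_proper; last by move=> x _; exact: A0.
  apply: filter_from_filter; first by exists x0.
  move=> x y _ _; have [xy|yx] := Achain x y; [exists x|exists y] => // t At.
    by split => //; exact: xy.
  by split => //; exact: yx.
have [//|t [_ Ft]] := cT F FF; first by exists x0.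
by exists t => x; apply: Acl => U tU; apply: Ft => //; exists x.
Qed.

Lemma derived_closed (T : topologicalType) (D : set T -> set T) a :
  (forall A, closed A -> closed (D A)) -> closed (derived D a).
Proof.
move=> Dcl; elim: a => X f IH.
have -> : derived D (Osup f) = \bigcap_x D (derived D (f x)).
  by apply/seteqP; split=> t /= tf x; [move=> _|]; exact: tf.
by apply: closed_bigI => x _; exact/Dcl/IH.
Qed.

Lemma derived_omega_sub (T : Type) (D : set T -> set T) a n :
  (forall A, D A `<=` A) ->
  derived D (oadd a oomega) `<=` iter n D (derived D a).
Proof.
move=> Dsub; have -> : iter n D (derived D a) = derived D (iter n osucc a).
  by elim: n => // n IH; rewrite !iterS IH derivedS.
exact/derived_anti/iter_osucc_le_omega.
Qed.

Section Termination.
Variables (T : topologicalType) (D : set T -> set T).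
Hypothesis T_compact : compact [set: T].
Hypothesis T_count : @second_countable T.
Hypothesis D_sub : forall A, D A `<=` A.
Hypothesis D_closed : forall A, closed A -> closed (D A).
Hypothesis D_strict : forall A, closed A -> A !=set0 -> D A <> A.

(** Otherwise the derivatives would decrease strictly for ever. Each step
    removes the last trace on some set of a countable basis, and different
    steps use different basic sets. So the steps are at most countably many,
    and their supremum is an ordinal beyond all of them. (A supremum indexed by
    the points of [T] would not be universe consistent.) *)
Lemma derived_terminates : exists a, derived D a = set0.
Proof.
apply: contrapT => /forallNP Dn0.
have [B cB [Bop Bbasis]] := T_count.
have [e Be] : exists e : nat -> set T, B `<=` range e.
  have /pfcard_geP[->|[h]] := cB; first by exists (fun=> set0).
  by exists h => b /(@surj _ _ _ _ h).
pose P n a := e n `&` derived D a !=set0 /\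
              e n `&` derived D (osucc a) = set0.
have PE a : exists n, P n a.
  have cl b : closed (derived D b) by exact: derived_closed.
  have D0 : derived D a !=set0 by exact/set0P/eqP/Dn0.
  have [t [at_ nt]] : exists t, derived D a t /\ ~ D (derived D a) t.
    apply: contrapT => /forallNP h; apply: (D_strict (cl a) D0).
    apply/seteqP; split; first exact: D_sub.
    by move=> t at_; apply: contrapT => nt; exact: (h t).
  have nbt : nbhs t (~` D (derived D a)).
    by apply: open_nbhs_nbhs; split=> //; exact/closed_openC/D_closed.
  have [b [Bb bt] bsub] := Bbasis _ _ nbt.
  have [n _ nb] := Be _ Bb; exists n; rewrite /P nb derivedS.
  split; first by exists t.
  by apply/seteqP; split=> // s [/bsub].
pose g n := xget ozero (P n).
have [n Pn] := PE (Osup g).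
have [_ gn0] : P n (g n) by rewrite /g; case: xgetP => // /(_ _ Pn).
have [[s [es Ds]] _] := Pn; suff: set0 s by [].
by rewrite -gn0; split => // _; exact: Ds.
Qed.

(** The least ordinal with an empty derivative is neither 0 nor, by
    compactness, a limit. *)
Lemma derived_largest : [set: T] !=set0 ->
  is_largest [set a | derived D a !=set0] (olargest [set a | derived D a !=set0]).
Proof.
move=> T0.
suff [b bP] : exists b, is_largest [set a | derived D a !=set0] b.
  exact: xgetPex (ex_intro _ b bP).
have [a a0] := derived_terminates.
elim/(well_founded_ind olt_wf): a a0 => -[X f] IH a0.
have [[b [ba b0]]|h] := pselect (exists b, olt b (Osup f) /\ derived D b = set0).
  exact: IH b0.
have iX : inhabited X.
  apply: contrapT => nX; case: T0 => t _; suff: set0 t by [].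
  by rewrite -a0 => x; case: nX.
have [x x0] : exists x, derived D (osucc (f x)) = set0.
  apply: contrapT => /forallNP n0.
  have [||||t tP] := @compact_bigcap_chain T X (fun x => derived D (osucc (f x))) _ iX.
  - exact: T_compact.
  - by move=> x; exact: derived_closed.
  - by move=> x; exact/set0P/eqP/n0.
  - move=> x y; have [xy|/oltW yx] := ole_or_olt (osucc (f x)) (osucc (f y)).
      by right; exact: derived_anti.
    by left; exact: derived_anti.
  suff: set0 t by [].
  by rewrite -a0 => x; have := tP x; rewrite derivedS.
exists (f x); split.
  apply/set0P/eqP => fx0; apply: h; exists (f x); split=> //.
  exact: olt_branch.
move=> b [t tb]; have [//|xb] := ole_or_olt b (f x).
have : derived D (osucc (f x)) t by apply: derived_anti tb => //; exact/ole_succ.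
by rewrite x0.
Qed.

End Termination.

(** * Selection of subsequences *)

Lemma history_choice (T : Type) (Q : seq T -> T -> Prop) :
  (forall h, exists x, Q h x) -> exists l : nat -> T, forall j, Q (mkseq l j) (l j).
Proof.
move=> /choice[c Qc].
pose H := fix H j := if j is i.+1 then rcons (H i) (c (H i)) else [::].
exists (fun j => c (H j)) => j.
have -> : mkseq (fun i => c (H i)) j = H j by elim: j => // j IH; rewrite mkseqS IH.
exact: Qc.
Qed.

Lemma sorted_subseq_iota s j :
  sorted ltn s -> all (ltn^~ j) s -> subseq s (iota 0 j).
Proof.
move=> ss sj; have -> : s = [seq i <- iota 0 j | i \in s].
  apply: (irr_sorted_eq ltn_trans ltnn) => //.
    exact/(sorted_filter ltn_trans)/iota_ltn_sorted.
  move=> i; rewrite mem_filter mem_iota add0n /=.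
  by case: (boolP (i \in s)) => // /(allP sj).
exact: filter_subseq.
Qed.

(** [l j] is chosen after [l 0], ..., [l (j - 1)] so as to extend every tuple of
    earlier terms for every [k <= j]. These are finitely many requirements, and
    [F] is stable under finite intersections. *)
Lemma diagonal_subsequence (F : set_system nat) (M : set nat)
    (G : nat -> seq nat -> Prop) :
  ProperFilter F -> F M -> (forall N, F [set n | (N <= n)%N]) ->
  (forall k, G k [::]) ->
  (forall k s, G k s -> \forall n \near F, G k (rcons s n)) ->
  exists l : nat -> nat, [/\ {homo l : i j / (i < j)%N}, range l `<=` M &
    forall k s, sorted ltn s -> all (leq k) s -> G k (map l s)].
Proof.
move=> FF FM Ftail G0 GS.
pose Q h n := [/\ M n, all (ltn^~ n) h & forall (k : 'I_(size h).+1)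
  (m : (size h).-tuple bool), G k (mask m h) -> G k (rcons (mask m h) n)].
have /history_choice[l lQ] : forall h, exists n, Q h n.
  move=> h; apply: (@filter_ex _ F).
  have Fh : F [set n | all (ltn^~ n) h].
    apply: filterS (Ftail (\max_(i <- h) i).+1) => n /= hn.
    apply/allP => i ih; apply: leq_trans hn; rewrite ltnS.
    exact: leq_bigmax_seq.
  suff FG : F [set n | forall (k : 'I_(size h).+1) (m : (size h).-tuple bool),
      G k (mask m h) -> G k (rcons (mask m h) n)].
    by apply: filterS3 FM Fh FG.
  apply: filter_forall => k; apply: filter_forall => m.
  have [Gm|nGm] := pselect (G k (mask m h)).
    by apply: filterS (GS _ _ Gm).
  exact: nearW.
exists l; split.
- apply: homo_ltn; first exact: ltn_trans.
  move=> i; have [_ /allP + _] := lQ i.+1; apply.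
  by rewrite mkseqS mem_rcons inE eqxx.
- by move=> _ [j _ <-]; have [] := lQ j.
move=> k; elim/last_ind => [|s j IH] //; rewrite map_rcons all_rcons.
move=> srj /andP[kj ks].
have [ss sj] : sorted ltn s /\ all (ltn^~ j) s.
  move: srj; rewrite -cats1 (sorted_pairwise ltn_trans) pairwise_cat allrel1r.
  by case/and3P => + + _; rewrite -(sorted_pairwise ltn_trans).
have /subseqP[m sm sE] := sorted_subseq_iota ss sj.
have sm' : size m == size (mkseq l j) by rewrite size_map sm.
have kj' : (k < (size (mkseq l j)).+1)%N by rewrite size_mkseq ltnS.
have [_ _ /(_ (Ordinal kj') (Tuple sm'))/=] := lQ j.
by rewrite -map_mask -sE; apply; exact: IH.
Qed.

(** * Limits *)

Section Limits.
Context {R : realType}.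
Implicit Types (u v : nat -> R) (c d : R).

(** Convergence is not assumed: a divergent sequence has [limn u = 0]. *)
Lemma limn_le u c : 0 <= c -> (forall n, u n <= c) -> limn u <= c.
Proof.
move=> c0 uc; have [cu|/dvgP->//] := pselect (cvgn u).
by apply: limr_le => //; exact: nearW.
Qed.

Lemma subadditive_mod v j k q : v 0%N = 0 ->
  (forall i j, v (i + j)%N <= v i + v j) -> v (q * k + j)%N <= q%:R * v k + v j.
Proof.
move=> v0 vD; elim: q => [|q IH]; first by rewrite mul0r add0r.
rewrite mulSn -addnA; apply: le_trans (vD _ _) _.
by rewrite -natr1 mulrDl mul1r [_ + v k]addrC -addrA lerD2l.
Qed.

(** Fekete: v k / k converges to its infimum. If v K / K is nearly minimal, then
    dividing k by K shows that v k / k is at most v K / K + O(1 / k). *)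
Lemma fekete v : v 0%N = 0 -> (forall k, 0 <= v k) ->
  (forall i j, v (i + j)%N <= v i + v j) -> cvgn (fun k => k%:R^-1 * v k).
Proof.
move=> v0 v_ge0 vD.
pose S := [set k%:R^-1 * v k | k in [set k | (0 < k)%N]].
have S0 : S !=set0 by exists (1%:R^-1 * v 1%N), 1%N.
have Slb : has_lbound S.
  by exists 0 => _ [k _ <-]; rewrite mulr_ge0 ?invr_ge0.
apply: (@cvgP _ _ (inf S)); apply/cvgrPdist_lt => e e0.
have [_ [K /= K0 <-] Ke] := inf_adherent (divr_gt0 e0 (ltr0Sn R 1)) (conj S0 Slb).
near=> k.
have k0 : (0 < k)%N by near: k; exact: nbhs_infty_gt.
have kR0 : 0 < k%:R :> R by rewrite ltr0n.
have KR0 : 0 < K%:R :> R by rewrite ltr0n.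
rewrite ltr_norml; apply/andP; split; last first.
  apply: le_lt_trans e0; rewrite subr_le0; apply: ge_inf => //.
  by exists k.
rewrite ltrNl opprB ltrBlDr addrC.
apply: (@le_lt_trans _ _ (K%:R^-1 * v K + k%:R^-1 * (K%:R * v 1%N))).
  rewrite ler_pdivrMl // mulrDr mulrA [k%:R * (k%:R^-1 * _)]mulrA divff ?gt_eqF //.
  rewrite mul1r {1}(divn_eq k K).
  apply: le_trans (subadditive_mod _ _ _ v0 vD) _; apply: lerD.
    rewrite ler_wpM2r // ler_pdivlMr // -natrM ler_nat.
    by rewrite {2}(divn_eq k K) leq_addr.
  have := subadditive_mod 0 1 (k %% K)%N v0 vD.
  rewrite addn0 muln1 v0 addr0 => /le_trans; apply.
  by rewrite ler_wpM2r // ler_nat ltnW // ltn_mod.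
have : k%:R^-1 * (K%:R * v 1%N) < e / 2.
  rewrite mulrC ltr_pdivrMr // [ltRHS]mulrC -ltr_pdivrMr ?divr_gt0 //.
  by near: k; exact: nbhs_infty_gtr.
lra.
Unshelve. all: by end_near. Qed.

End Limits.

(** * The spreading model quantity *)

Definition increasing_from (k m : nat) : set (seq nat) :=
  [set s | [/\ sorted ltn s, all (leq m) s & size s = k]].

Lemma increasing_from_iota k m : increasing_from k m (iota m k).
Proof.
split; [exact: iota_ltn_sorted| |exact: size_iota].
by apply/allP => i; rewrite mem_iota => /andP[].
Qed.

Lemma increasing_from_mono k m m' :
  (m <= m')%N -> increasing_from k m' `<=` increasing_from k m.
Proof.
move=> mm' s [ss m's sk]; split => //.
by apply/allP => i /(allP m's); exact: leq_trans.
Qed.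

Lemma increasing_from_cat j k m s : increasing_from j m s ->
  exists m', (m <= m')%N /\
    forall t, increasing_from k m' t -> increasing_from (j + k) m (s ++ t).
Proof.
move=> [ss ms sj]; exists (maxn m (\max_(i <- s) i).+1); split.
  exact: leq_maxl.
move=> t [st m't tk]; split.
- rewrite (sorted_pairwise ltn_trans) pairwise_cat -!(sorted_pairwise ltn_trans).
  rewrite ss st !andbT; apply/allrelP => x y xs /(allP m't).
  rewrite geq_max => /andP[_]; apply: leq_trans.
  by rewrite ltnS; exact: leq_bigmax_seq.
- rewrite all_cat ms /=; apply/allP => y /(allP m't).
  by rewrite geq_max => /andP[].
- by rewrite size_cat sj tk.
Qed.

Section SpreadingModel.
Context {R : realType}.
Variables (N : seq nat -> R) (B : R).
Hypothesis N_ge0 : forall s, 0 <= N s.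
Hypothesis N_cat : forall s t, N (s ++ t) <= N s + N t.
Hypothesis N_bound : forall s, N s <= (size s)%:R * B.

Definition least_average (k m : nat) : R :=
  inf [set k%:R^-1 * N s | s in increasing_from k m].

Let average_ge0 k m :
  lbound [set k%:R^-1 * N s | s in increasing_from k m] 0.
Proof. by move=> _ [s _ <-]; rewrite mulr_ge0 // invr_ge0. Qed.

Lemma least_average_le k m s :
  increasing_from k m s -> least_average k m <= k%:R^-1 * N s.
Proof.
by move=> ms; apply: ge_inf; [exists 0; exact: average_ge0|exists s].
Qed.

Lemma le_least_average k m c :
  (forall s, increasing_from k m s -> c <= k%:R^-1 * N s) ->
  c <= least_average k m.
Proof.
move=> cN; apply: lb_le_inf; last by move=> _ [s ms <-]; exact: cN.
by exists (k%:R^-1 * N (iota m k)), (iota m k) => //; exact: increasing_from_iota.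
Qed.

Let B_ge0 : 0 <= B.
Proof. by have := le_trans (N_ge0 [:: 0%N]) (N_bound _); rewrite mul1r. Qed.

Lemma least_average_nd k :
  {homo least_average k : m m' / (m <= m')%N >-> m <= m'}.
Proof.
move=> m m' mm'; apply: le_least_average => s /(increasing_from_mono mm').
exact: least_average_le.
Qed.

Lemma least_average_cvg k : cvgn (least_average k).
Proof.
apply: nondecreasing_is_cvgn; first exact: least_average_nd.
exists B => _ [m _ <-].
apply: le_trans (least_average_le (increasing_from_iota k m)) _.
case: k => [|k]; first by rewrite invr0 mul0r.
by rewrite ler_pdivrMl ?ltr0n //; have := N_bound (iota m k.+1); rewrite size_iota.
Qed.

Lemma least_average_lim_ge k m : least_average k m <= limn (least_average k).
Proof.
apply: nondecreasing_cvgn_le; first exact: least_average_nd.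
exact: least_average_cvg.
Qed.

(** Far enough out, an almost optimal j-tuple can be followed by an almost
    optimal k-tuple. *)
Lemma least_average_subadditive j k :
  (j + k)%:R * limn (least_average (j + k)) <=
  j%:R * limn (least_average j) + k%:R * limn (least_average k).
Proof.
have near_opt e i m : 0 < e -> exists2 s, increasing_from i m s &
    N s <= i%:R * (limn (least_average i) + e).
  move=> e0; have hinf : has_inf [set i%:R^-1 * N s | s in increasing_from i m].
    split; last by exists 0; exact: average_ge0.
    by exists (i%:R^-1 * N (iota m i)), (iota m i) => //; exact: increasing_from_iota.
  have [_ [s ms <-] sE] := inf_adherent e0 hinf; exists s => //.
  case: i ms sE {hinf} => [|i] ms sE.
    by case: ms => _ _ /size0nil ->; have := N_bound [::]; rewrite !mul0r.
  rewrite -ler_pdivrMl ?ltr0n //; apply: ltW; apply: lt_le_trans sE _.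
  by rewrite lerD2r; exact: least_average_lim_ge.
case: (posnP (j + k)) => [/eqP|jk0].
  by rewrite addn_eq0 => /andP[/eqP-> /eqP->]; rewrite !mul0r addr0.
have jkR0 : 0 < (j + k)%:R :> R by rewrite ltr0n.
apply/ler_addgt0Pl => e e0; rewrite -ler_pdivlMl //.
apply: limr_le; first exact: least_average_cvg.
apply: nearW => m; rewrite ler_pdivlMl //.
pose d := e / (j + k)%:R; have d0 : 0 < d by rewrite divr_gt0.
have [s ms Ns] := near_opt d j m d0.
have [m' [_ m'P]] := increasing_from_cat k ms.
have [t mt Nt] := near_opt d k m' d0.
rewrite -ler_pdivlMl //; apply: le_trans (least_average_le (m'P t mt)) _.
rewrite ler_pM2l ?invr_gt0 //; apply: le_trans (N_cat _ _) _.
apply: le_trans (lerD Ns Nt) _; rewrite !mulrDr addrACA -mulrDl -natrD.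
by rewrite [_ * d]mulrC /d divfK ?gt_eqF // addrC.
Qed.

Lemma spreading_cvg : cvgn (fun k => limn (least_average k)).
Proof.
pose v k := k%:R * limn (least_average k).
have -> : (fun k => limn (least_average k)) = (fun k => k%:R^-1 * v k).
  apply/funext => -[|k]; last by rewrite mulKf.
  rewrite invr0 mul0r; apply: le_anti; apply/andP; split.
    apply: limn_le => // m; apply: le_trans (least_average_le _) _.
      exact: increasing_from_iota.
    by rewrite invr0 mul0r.
  apply: le_trans (least_average_lim_ge 0 0).
  by apply: le_least_average => s _; rewrite invr0 mul0r.
apply: fekete => [|k|j k]; first by rewrite /v mul0r.
  rewrite mulr_ge0 //; apply: le_trans (least_average_lim_ge k 0).
  by apply: le_least_average => s _; rewrite mulr_ge0 // invr_ge0.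
exact: least_average_subadditive.
Qed.

(** The bound is only asked of k-tuples of numbers >= k, and it may fall short of
    [c] by 1 / (k + 1). This is what a diagonal sequence can provide. *)
Lemma le_spreading c :
  (forall k s, increasing_from k k s -> k%:R * (c - k.+1%:R^-1) <= N s) ->
  c <= limn (fun k => limn (least_average k)).
Proof.
move=> cN; apply/ler_addgt0Pr => e e0; rewrite -lerBlDr.
apply: limr_ge; first exact: spreading_cvg.
near=> k.
have k0 : (0 < k)%N by near: k; exact: nbhs_infty_gt.
apply: le_trans (least_average_lim_ge k k).
apply: le_least_average => s /cN; rewrite ler_pdivlMl ?ltr0n //; apply: le_trans.
rewrite ler_pM2l ?ltr0n // lerD2l lerN2 ltW //.
by near: k; exact: near_infty_natSinv_lt (PosNum e0).
Unshelve. all: by end_near. Qed.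

End SpreadingModel.

Section Supnorm.
Context {R : realType} {T : Type}.
Implicit Types (A : set T) (g : T -> R).

Lemma supnorm_le A g c : 0 <= c -> (forall t, A t -> `|g t| <= c) -> supnorm A g <= c.
Proof.
move=> c0 gc; rewrite /supnorm; have [->|/set0P[t At]] := eqVneq A set0.
  by rewrite image_set0 sup0.
by apply: ge_sup => [|_ [s As <-]]; [exists `|g t|, t|exact: gc].
Qed.

Lemma le_supnorm A g c t :
  (forall t, `|g t| <= c) -> A t -> `|g t| <= supnorm A g.
Proof.
move=> gc At; apply: ub_le_sup; last by exists t.
by exists c => _ [s _ <-]; exact: gc.
Qed.

Lemma supnorm_ge0 A g c : (forall t, `|g t| <= c) -> 0 <= supnorm A g.
Proof.
move=> gc; have [->|/set0P[t At]] := eqVneq A set0.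
  by rewrite /supnorm image_set0 sup0.
by apply: le_trans (normr_ge0 (g t)) (le_supnorm gc At).
Qed.

(** Strictly increasing tuples can be concatenated, so they are more convenient
    than strictly increasing maps out of 'I_k. *)
Lemma l1SP_least_average A (e : nat -> T -> R) :
  l1SP A e =
  limn (fun k => limn (least_average
    (fun s => supnorm A (fun t => \sum_(i <- s) e i t)) k)).
Proof.
rewrite /l1SP; congr (limn _); apply/funext => k; congr (limn _).
apply/funext => m; rewrite /least_average; congr inf.
apply/seteqP; split=> [_ [n [mn nh] <-]|_ [s [ss ms sk] <-]].
  exists [seq n i | i <- enum 'I_k].
    split; last by rewrite size_map size_enum_ord.
      rewrite (homo_sorted (e := fun i j : 'I_k => (i < j)%N)) //.
      by have := iota_ltn_sorted 0 k; rewrite -val_enum_ord sorted_map.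
    by apply/allP => _ /mapP[i _ ->]; exact: mn.
  congr (_ * supnorm _ _); apply/funext => t.
  by rewrite big_map big_enum.
exists (fun i : 'I_k => nth 0%N s i).
  split=> [i|i j ij].
    by apply: (allP ms); rewrite mem_nth // sk.
  by apply: (sorted_ltn_nth ltn_trans) => //; rewrite inE sk.
congr (_ * supnorm _ _); apply/funext => t.
by rewrite (big_nth 0%N) sk big_mkord.
Qed.

Variables (f : nat -> T -> R) (B : R).
Hypothesis f_bound : forall n t, `|f n t| <= B.

Let sum_bound (l : nat -> nat) s t : `|\sum_(i <- s) f (l i) t| <= (size s)%:R * B.
Proof.
elim: s => [|i s IH]; first by rewrite big_nil normr0 mul0r.
rewrite big_cons; apply: le_trans (ler_normD _ _) _.
by rewrite /= -natr1 mulrDl mul1r addrC lerD.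
Qed.

Lemma l1SP_le A (l : nat -> nat) c :
  0 <= c -> (forall n t, A t -> `|f (l n) t| <= c) -> l1SP A (fun i => f (l i)) <= c.
Proof.
move=> c0 fc; rewrite l1SP_least_average.
apply: limn_le => // k; apply: limn_le => // m.
apply: le_trans (least_average_le _ (increasing_from_iota k m)) _.
  by move=> s; exact: supnorm_ge0 (sum_bound l s).
case: k => [|k]; first by rewrite invr0 mul0r.
rewrite ler_pdivrMl ?ltr0n //; apply: supnorm_le; first by rewrite mulr_ge0.
move=> t At; have := size_iota m k.+1; move: (iota _ _) => s <-.
elim: s => [|i s IH]; first by rewrite big_nil normr0 mul0r.
rewrite big_cons; apply: le_trans (ler_normD _ _) _.
by rewrite /= -natr1 mulrDl mul1r addrC lerD // fc.
Qed.

Lemma le_l1SP A (l : nat -> nat) c :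
  (forall k s, increasing_from k k s -> exists2 t, A t &
     k%:R * (c - k.+1%:R^-1) <= `|\sum_(i <- s) f (l i) t|) ->
  c <= l1SP A (fun i => f (l i)).
Proof.
move=> cf; have B0 (t : T) : 0 <= B by exact: le_trans (f_bound 0 t).
rewrite l1SP_least_average.
have [t0 _ _] := cf _ _ (increasing_from_iota 0 0).
apply: (@le_spreading _ _ B).
- by move=> s; exact: supnorm_ge0 (sum_bound l s).
- move=> s s'; apply: supnorm_le => [|t At].
    by rewrite addr_ge0 //; [exact: supnorm_ge0 (sum_bound l s)
                            |exact: supnorm_ge0 (sum_bound l s')].
  rewrite big_cat; apply: le_trans (ler_normD _ _) _.
  by apply: lerD; apply: (le_supnorm (sum_bound l _)).
- move=> s; apply: supnorm_le => [|t _]; last exact: sum_bound.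
  by rewrite mulr_ge0 // B0.
move=> k s /cf[t At] /le_trans; apply; exact: (le_supnorm (sum_bound l _)).
Qed.

End Supnorm.

(** * Weakly null sequences *)

Section WeaklyNull.
Context {R : realType} {K : metricType R}.
Hypothesis K_compact : compact [set: K].
Variable f : nat -> continuousType K R.
Hypothesis f_null : weakly_null f.

Lemma norm_attained (g : continuousType K R) :
  [set: K] !=set0 -> exists t, forall s, `|g s| <= `|g t|.
Proof.
move=> K0; have [|t _ tP] := @compact_EVT_max _ _ (fun s => `|g s|) _ K0 K_compact.
  apply: continuous_subspaceT => s; apply: (@continuous_comp _ _ _ g Num.norm).
    exact: cts_fun.
  exact: norm_continuous.
by exists t => s; exact/tP/in_setT.
Qed.

Lemma continuous_le_supnorm (g : continuousType K R) t : `|g t| <= supnorm setT g.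
Proof.
have [s sP] : exists s, forall t, `|g t| <= `|g s| by apply: norm_attained; exists t.
exact: le_supnorm sP _.
Qed.

Lemma weakly_null_pointwise t : (fun n => f n t) @ \oo --> (0 : R).
Proof.
apply: (f_null (phi := fun g => g t)); split=> [c g h u -> //|].
by exists 1 => g; rewrite mul1r; exact: continuous_le_supnorm.
Qed.

Section WeightedSum.
Variable x : nat -> K.

Let term (g : K -> R) : nat -> R := fun j => 3^-1 ^+ j * g (x j).

Let weighted_sum (g : K -> R) : R := limn (series (term g)).

Let geometric_sum n : \sum_(0 <= i < n) 3^-1 ^+ i = 3 / 2 * (1 - 3^-1 ^+ n) :> R.
Proof.
elim: n => [|n IH]; first by rewrite big_nil expr0 subrr mulr0.
by rewrite big_nat_recr //= IH exprS; lra.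
Qed.

Let sum_cvg (g : continuousType K R) : cvgn (series (term g)).
Proof.
apply: (@normed_cvg _ R^o).
apply: (@series_le_cvg _ _ (geometric (supnorm setT g) 3^-1)) => [n|n|n|].
- by rewrite normr_ge0.
- by rewrite mulr_ge0 ?exprn_ge0 ?invr_ge0 //; exact: le_trans (continuous_le_supnorm g (x 0%N)).
- rewrite /= normrM normrX ger0_norm ?invr_ge0 // mulrC.
  by rewrite ler_wpM2r ?exprn_ge0 ?invr_ge0 //; exact: continuous_le_supnorm.
- by apply: is_cvg_geometric_series; rewrite ger0_norm ?invr_ge0 // invf_lt1 // ltr1n.
Qed.

Lemma weighted_sum_bounded : bounded_functional weighted_sum.
Proof.
split=> [c g h u uE|].
  apply: cvg_lim => //.
  have -> : series (term u) =
      (fun n => c * series (term g) n + series (term h) n).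
    apply/funext => n; rewrite /series /= mulr_sumr -big_split /=.
    by apply: eq_bigr => i _; rewrite /term uE mulrDr mulrCA.
  by apply: cvgD; [apply: cvgMr; exact: sum_cvg|exact: sum_cvg].
exists (3 / 2) => g.
have le_sum n : `|series (term g) n| <= 3 / 2 * supnorm setT g.
  have C0 : 0 <= supnorm setT g.
    exact: le_trans (continuous_le_supnorm g (x 0%N)).
  apply: le_trans (ler_norm_sum _ _ _) _.
  apply: (@le_trans _ _ (\sum_(0 <= i < n) 3^-1 ^+ i * supnorm setT g)).
    apply: ler_sum => i _; rewrite normrM normrX ger0_norm ?invr_ge0 //.
    by rewrite ler_wpM2l ?exprn_ge0 ?invr_ge0 //; exact: continuous_le_supnorm.
  rewrite -mulr_suml geometric_sum; apply: ler_wpM2r => //.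
  have : 0 <= 3^-1 ^+ n :> R by rewrite exprn_ge0 ?invr_ge0.
  lra.
rewrite ler_norml; apply/andP; split.
  apply: limr_ge; [exact: sum_cvg|apply: nearW => n].
  by have := le_sum n; rewrite ler_norml => /andP[].
apply: limr_le; [exact: sum_cvg|apply: nearW => n].
by have := le_sum n; rewrite ler_norml => /andP[].
Qed.

(** The terms after [j] contribute at most half as much as term [j]. *)
Lemma weighted_sum_ge (g : continuousType K R) j c :
  (forall t, `|g t| <= `|g (x j)|) ->
  \sum_(0 <= i < j) 3^-1 ^+ i * `|g (x i)| <= c ->
  3^-1 ^+ j / 2 * `|g (x j)| - c <= `|weighted_sum g|.
Proof.
move=> gx gc.
(* The weights from index j + 1 + m on add up to 3 / 2 * 3^-(j + 1 + m). *)
have part m : (3^-1 ^+ j / 2 + 3 / 2 * 3^-1 ^+ (j.+1 + m)) * `|g (x j)| - c <=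
    `|series (term g) (j.+1 + m)%N|.
  have r0 i : 0 <= 3^-1 ^+ i :> R by rewrite exprn_ge0 ?invr_ge0.
  have termE i : `|term g i| = 3^-1 ^+ i * `|g (x i)|.
    by rewrite normrM ger0_norm.
  elim: m => [|m IH].
    rewrite addn0 /series /= big_nat_recr //= addrC.
    apply: le_trans (lerB_normD _ _); rewrite termE exprS.
    have : `|\sum_(0 <= i < j) term g i| <= c.
      apply: le_trans (ler_norm_sum _ _ _) _; apply: le_trans gc.
      by apply: ler_sum => i _; rewrite termE.
    by move: (3^-1 ^+ j) (r0 j) => r; lra.
  rewrite addnS seriesSr; apply: le_trans (lerB_normD _ _).
  have := ler_wpM2l (r0 (j.+1 + m)%N) (gx (x (j.+1 + m)%N)).
  rewrite -termE exprS; move: IH.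
  by move: (3^-1 ^+ j) (3^-1 ^+ (j.+1 + m)) => r r'; lra.
have ncvg : (fun n => `|series (term g) n|) @ \oo --> `|weighted_sum g|.
  by apply: cvg_norm; exact: sum_cvg.
rewrite -(cvg_lim _ ncvg) //; apply: limr_ge; first by apply: cvgP ncvg.
exists j.+1 => // n /= jn; rewrite -(subnKC jn); apply: le_trans (part _).
by rewrite lerD2r ler_wpM2r // lerDl mulr_ge0 ?divr_ge0 // exprn_ge0 ?invr_ge0.
Qed.

End WeightedSum.

(** This is the uniform boundedness principle, by a gliding hump: if the norms
    were unbounded, then the functional g |-> sum_j 3^-j g(x_j) would be
    unbounded on the sequence, for x_j a point where some f_n with a large
    enough norm attains it. What large enough means depends on bounds, uniform
    in n, for the values f_n(x_i) with i < j. *)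
Lemma weakly_null_bounded : exists B, forall n t, `|f n t| <= B.
Proof.
have [K0|K0] := pselect ([set: K] !=set0); last first.
  by exists 0 => n t; case: K0; exists t.
have /choice[p pmax] : forall n, exists q, forall s, `|f n s| <= `|f n q|.
  by move=> n; exact: norm_attained.
have /choice[C Cf] : forall t, exists c, forall n, `|f n t| <= c.
  move=> t.
  have /cvg_seq_bounded[B [_ fB]] := cvgP _ (weakly_null_pointwise t).
  by exists (B + 1) => n; apply: fB => //; rewrite ltrDl.
apply: contrapT => nB.
pose Q (h : seq nat) n := (size h)%:R +
  \sum_(0 <= i < size h) 3^-1 ^+ i * C (p (nth 0%N h i)) <=
  3^-1 ^+ (size h) / 2 * `|f n (p n)|.
have [l lQ] : exists l, forall j, Q (mkseq l j) (l j).
  apply: (@history_choice _ Q) => h; rewrite /Q.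
  apply: contrapT => /forallNP nh; apply: nB.
  set c := _ + _ in nh; exists (c / (3^-1 ^+ (size h) / 2)) => n t.
  apply: le_trans (pmax n t) _; rewrite ler_pdivlMr; last first.
    by rewrite divr_gt0 // exprn_gt0 // invr_gt0.
  by rewrite mulrC leNgt; apply/negP => /ltW; exact: nh.
have phi_null := f_null (weighted_sum_bounded (fun j => p (l j))).
have /cvg_seq_bounded[B [_ fB]] := cvgP _ phi_null.
have := fB (B + 1); rewrite ltrDl => /(_ ltr01) {}fB.
have [j Bj] : exists j : nat, B + 1 < j%:R.
  by exists (Num.truncn (B + 1)).+1; exact: truncnS_gt.
have := fB (l j) I; apply/negP; rewrite -ltNge; apply: lt_le_trans Bj _.
apply: le_trans (@weighted_sum_ge (fun j => p (l j)) (f (l j)) j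
  (\sum_(0 <= i < j) 3^-1 ^+ i * C (p (l i))) (pmax (l j)) _); last first.
  by apply: ler_sum => i _; rewrite ler_wpM2l // exprn_ge0 ?invr_ge0.
rewrite /= lerBrDr.
have := lQ j; rewrite /Q size_mkseq.
rewrite (eq_big_nat _ _ (F2 := fun i => 3^-1 ^+ i * C (p (l i)))) // => i /andP[_ ij].
by rewrite nth_mkseq.
Qed.

End WeaklyNull.

(** * One derivation step *)

Lemma finite_nat_bounded (M : set nat) :
  finite_set M -> exists N, forall n, M n -> (n < N)%N.
Proof.
move=> /finite_seqP[s ->]; exists (\max_(i <- s) i).+1 => n /= ns.
by rewrite ltnS; exact: leq_bigmax_seq.
Qed.

Lemma infinite_nat_unbounded (M : set nat) :
  infinite_set M -> forall N, exists2 n, M n & (N <= n)%N.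
Proof.
move=> Minf N; apply: contrapT => h; apply: Minf.
apply: sub_finite_set (finite_II N) => n Mn /=; rewrite ltnNge; apply/negP => Nn.
by apply: h; exists n.
Qed.

Lemma infinite_ultrafilter (M : set nat) : infinite_set M ->
  exists F : set_system nat,
    [/\ UltraFilter F, F M & forall N, F [set n | (N <= n)%N]].
Proof.
move=> /infinite_nat_unbounded Minf.
pose F0 := filter_from [set: nat] (fun N => M `&` [set n | (N <= n)%N]).
have F0F : ProperFilter F0.
  apply: filter_from_proper => [|N _]; last first.
    by have [n Mn Nn] := Minf N; exists n.
  apply: filter_from_filter; first by exists 0%N.
  move=> i j _ _; exists (maxn i j) => // n [Mn] /=.
  by rewrite geq_max => /andP[].
have [F [FU F0_sub]] := ultraFilterLemma F0F.
exists F; split => // [|N]; apply: F0_sub; first by exists 0%N => // n [].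
by exists N => // n [].
Qed.

(** Both derivations have this form, which is why all derivatives are closed. *)
Lemma closed_local (T : topologicalType) (A : set T) (P : set T -> Prop) :
  closed A -> closed [set t | A t /\ forall U, nbhs t U -> P U].
Proof.
move=> Acl t tcl; split=> [|U tU].
  by apply: Acl => U /tcl[s [[As _] Us]]; exists s.
have [s [[_ Ps] Us]] := tcl _ (nbhs_interior tU).
exact: Ps.
Qed.

Lemma iter_sub (T : Type) (D : set T -> set T) (A : set T) i j :
  (forall A, D A `<=` A) -> (i <= j)%N -> iter j D A `<=` iter i D A.
Proof.
move=> Dsub /subnK <-; elim: (j - i)%N => // n IH t /Dsub; exact: IH.
Qed.

Section Oscillation.
Context {R : realType} {K : metricType R}.
Hypothesis K_compact : compact [set: K].
Variable f : nat -> continuousType K R.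
Hypothesis f_null : weakly_null f.
Implicit Types (A B U : set K) (e : R).

Lemma osc_derivative_closed e A : closed A -> closed (osc_derivative f e A).
Proof. exact: closed_local. Qed.

Lemma SP_derivative_closed e A : closed A -> closed (SP_derivative f e A).
Proof.
move=> Acl; exact: (@closed_local K A (fun U => forall M : set nat, _ -> _)).
Qed.

Lemma near_lt_all (g : nat -> K -> R) c (s : seq nat) t :
  (forall n, continuous (g n)) -> (forall n, n \in s -> c < g n t) ->
  \forall u \near t, forall n, n \in s -> c < g n u.
Proof.
move=> gc; elim: s => [|i s IH] cg; first by apply: nearW.
have ci : \forall u \near t, c < g i u.
  by apply: (@cvgr_gt _ _ _ _ _ (g i t)); [exact: gc|apply: cg; rewrite inE eqxx].
have cs : \forall u \near t, forall n, n \in s -> c < g n u.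
  by apply: IH => n ns; apply: cg; rewrite inE ns orbT.
apply: filterS2 ci cs => u cu su n; rewrite inE => /orP[/eqP->//|]; exact: su.
Qed.

(** Since f_m(y) tends to 0, the differences f_n(y) - f_m(y) in the definition
    can be replaced by f_n(y), up to the difference between < and <=. *)
Lemma osc_derivative_near e A x U : osc_derivative f e A x -> nbhs x U ->
  \forall n \near \oo, exists y, [/\ U y, A y & e <= f n y \/ e <= - f n y].
Proof.
have lim_ge a y M (s : R) : (forall m, (M <= m)%N -> e <= a - s * f m y) -> e <= a.
  move=> ea; have c0 : (fun m => a - s * f m y) @ \oo --> a.
    rewrite -[X in _ --> X]subr0 -[X in _ - X](mulr0 s).
    apply: cvgB; first exact: cvg_cst.
    by apply: cvgMr; exact: weakly_null_pointwise.
  rewrite -(cvg_lim _ c0) //; apply: limr_ge; first exact: cvgP c0.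
  by exists M => // m /ea.
move=> [_ xD] xU; have [N NP] := xD U xU; exists N => // n /= /NP[M [|]].
  move=> [y [[yM Ay] Uy]]; exists y; split => //; left.
  apply: (@lim_ge _ y M 1) => m /yM; rewrite /Aplus /= mul1r; exact: ltW.
move=> [y [[yM Ay] Uy]]; exists y; split => //; right.
by apply: (@lim_ge _ y M (-1)) => m /yM; rewrite /Aminus /=; lra.
Qed.

Lemma near_osc_derivative e A x : A x -> (forall U, nbhs x U ->
    \forall n \near \oo, exists y, [/\ U y, A y & e < `|f n y|]) ->
  osc_derivative f e A x.
Proof.
move=> Ax xD; split=> // U /xD[N _ NP]; exists N => n /NP[y [Uy Ay en]].
have fy d : 0 < d -> \forall m \near \oo, `|f m y| < d.
  move=> d0; have /cvgrPdist_lt/(_ d d0) := weakly_null_pointwise K_compact f_null y.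
  by apply: filterS => m; rewrite sub0r normrN.
move: en; rewrite lter_normr => /orP[] en.
  have [M _ MP] := fy (f n y - e) ltac:(by rewrite subr_gt0).
  exists M; left; exists y; split=> //; split=> // m /MP /=.
  by rewrite ltr_norml /Aplus /= => /andP[_]; lra.
have [M _ MP] := fy (- f n y - e) ltac:(by rewrite subr_gt0).
exists M; right; exists y; split=> //; split=> // m /MP /=.
by rewrite ltr_norml /Aminus /= => /andP[+ _]; lra.
Qed.

(** If the oscillation condition fails, then |f_n| <= e' on U for infinitely many
    n, and no subsequence of these f_n has averages above e'. *)
Lemma SP_derivative_osc e e' A B : 0 < e' -> e' < e -> A `<=` B ->
  SP_derivative f e A `<=` osc_derivative f e' B.
Proof.
move=> e'0 e'e AB x [Ax xD]; apply: near_osc_derivative; first exact: AB.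
move=> U xU; apply: contrapT => nU.
pose M := [set n | ~ exists y, [/\ U y, B y & e' < `|f n y|]].
have /(xD U xU)[l [_ lM]] : infinite_set M.
  move=> /finite_nat_bounded[N NP]; apply: nU; exists N => // n /= Nn.
  by apply: contrapT => /NP; rewrite ltnNge Nn.
apply/negP; rewrite -ltNge; apply: le_lt_trans e'e.
have [C fC] := weakly_null_bounded K_compact f_null.
apply: (l1SP_le fC); first exact: ltW.
move=> n t [Ut At]; rewrite leNgt; apply/negP => e'f.
have : M (l n) by apply: lM; exists n.
by case; exists t; split => //; exact: AB.
Qed.

(** A fixed point A of the derivation would contain points y_1, y_2, ... such
    that |f_n| > e / 2 at y_k for the first k members n of one subsequence. By
    compactness |f_n| >= e / 2 along this subsequence at some point. *)
Lemma osc_derivative_strict e A : 0 < e -> closed A -> A !=set0 ->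
  osc_derivative f e A <> A.
Proof.
move=> e0 Acl A0 DA.
pose G (k : nat) (s : seq nat) := exists2 y, A y & forall n, n \in s -> e / 2 < `|f n y|.
have [||||l [lh _ lG]] := @diagonal_subsequence \oo setT G _.
- exact: filterT.
- by move=> N; exists N.
- by move=> k; have [y Ay] := A0; exists y.
- move=> k s [y Ay ys]; have Dy : osc_derivative f e A y by rewrite DA.
  have sc n : continuous (fun t => `|f n t|).
    move=> t; apply: (@continuous_comp _ _ _ (f n) Num.norm); first exact: cts_fun.
    exact: norm_continuous.
  apply: filterS (osc_derivative_near Dy (near_lt_all sc ys)) => n [z [zs Az zn]].
  exists z => // i; rewrite mem_rcons inE => /orP[/eqP->|]; last exact: zs.
  have : e <= `|f n z| by rewrite ler_normr; apply/orP.
  by lra.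
pose C j := [set z | A z /\ forall i, (i < j)%N -> e / 2 <= `|f (l i) z|].
have Canti i j : (i <= j)%N -> C j `<=` C i.
  by move=> ij z [Az zj]; split=> // m mi; apply: zj; exact: leq_trans ij.
have [|||t tC] := @compact_bigcap_chain K nat C K_compact (inhabits 0%N).
- move=> j; have -> : C j = A `&` \bigcap_(i in `I_j) [set z | e / 2 <= `|f (l i) z|].
    by apply/seteqP; split=> z [].
  apply: closedI => //; apply: closed_bigI => i _.
  apply: (@closed_comp _ _ (fun z => `|f (l i) z|) [set r | e / 2 <= r]); last exact: closed_ge.
  move=> z _; apply: (@continuous_comp _ _ _ (f (l i)) Num.norm); first exact: cts_fun.
  exact: norm_continuous.
- move=> j; have [|z Az zj] := lG 0%N (iota 0 j) (iota_ltn_sorted _ _).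
    by apply/allP.
  exists z; split=> // i ij; apply/ltW/zj; rewrite map_f // mem_iota.
  by rewrite add0n.
- move=> i j; have [ij|/ltnW ji] := leqP i j; [right|left]; exact: Canti.
have /cvgrPdist_lt/(_ (e / 2)) := weakly_null_pointwise K_compact f_null t.
rewrite divr_gt0 // => /(_ isT)[N _ NP].
have lN : (N <= l N)%N.
  by elim: N {NP} => // N IH; apply: leq_ltn_trans IH (lh _ _ _).
have := NP _ lN; rewrite sub0r normrN => /lt_geF.
by have [_ /(_ N (ltnSn N)) ->] := tC N.+1.
Qed.

End Oscillation.

(** * omega oscillation steps make one spreading model step *)

Section SignedDerivative.
Context {R : realType} {K : metricType R}.
Variable F : set_system nat.
Hypothesis F_ultra : UltraFilter F.
Hypothesis F_tail : forall N, F [set n | (N <= n)%N].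
Implicit Types (A S T U : set K) (g : nat -> K -> R).

(** The oscillation derivative with [for all large n] weakened to
    [for F-almost all n], and with only one of the two signs. *)
Definition signed_derivative g (e : R) A : set K :=
  [set x | A x /\ forall U, nbhs x U ->
    \forall n \near F, exists y, [/\ U y, A y & e <= g n y]].

Let F_proper : ProperFilter F.
Proof. exact: ultra_proper. Qed.

Lemma iter_signed_derivative_closed g e A n :
  closed A -> closed (iter n (signed_derivative g e) A).
Proof.
by move=> Acl; elim: n => //= n IH; exact: closed_local.
Qed.

Lemma signed_derivative_cover g e A S T x :
  A `<=` S `|` T -> closed T -> signed_derivative g e A x -> ~ T x ->
  signed_derivative g e S x.
Proof.
move=> AST Tcl [Ax xD] nTx.
have ST z : A z -> ~ T z -> S z by move=> /AST[].
split=> [|U xU]; first exact: ST.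
have xUT : nbhs x (U `&` ~` T).
  by apply: filterI => //; apply: open_nbhs_nbhs; split=> //; exact: closed_openC.
apply: filterS (xD _ xUT) => n [y [[Uy nTy] Ay ny]].
by exists y; split=> //; exact: ST.
Qed.

Variable f : nat -> continuousType K R.
Hypothesis K_compact : compact [set: K].
Hypothesis f_null : weakly_null f.

Let fp : nat -> K -> R := fun n t => f n t.
Let fn : nat -> K -> R := fun n t => - f n t.

(** The ultrafilter decides which of the two signs prevails at a point. *)
Lemma osc_derivative_sign e A x : osc_derivative f e A x ->
  signed_derivative fp e A x \/ signed_derivative fn e A x.
Proof.
move=> xD; have Ax : A x by case: xD.
apply: contrapT => /not_orP[np nn].
have neg g : ~ signed_derivative g e A x -> exists2 U, nbhs x U &
    F [set n | ~ exists y, [/\ U y, A y & e <= g n y]].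
  move=> nD; apply: contrapT => h; apply: nD; split=> // U xU.
  have [//|FU] := in_ultra_setVsetC [set n | exists y, [/\ U y, A y & e <= g n y]] F_ultra.
  by case: h; exists U.
have [U xU FU] := neg _ np; have [V xV FV] := neg _ nn.
have [N _ NP] := osc_derivative_near K_compact f_null xD (filterI xU xV).
have [n [[Un Vn] /NP[y [[Uy Vy] Ay [yp|yn]]]]] :=
  filter_ex (filterI (filterI FU FV) (F_tail N)).
  by apply: Un; exists y.
by apply: Vn; exists y.
Qed.

(** At a point x of the derivative of order i + j + 2, one sign prevails, say
    the positive one. The points of the derivative of order i + j + 1 are of
    positive order i or of negative order j + 1. If x is not of negative order
    j + 1, then by closedness neither are the points close to x. So these are of
    positive order i, and x is of positive order i + 1. *)
Lemma iter_osc_derivative_sign e A i j : closed A ->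
  iter (i + j) (osc_derivative f e) A `<=`
  iter i (signed_derivative fp e) A `|` iter j (signed_derivative fn e) A.
Proof.
move=> Acl; pose P i := iter i (signed_derivative fp e) A.
pose N j := iter j (signed_derivative fn e) A.
suff IH n : forall i j, (i + j)%N = n ->
  iter n (osc_derivative f e) A `<=` P i `|` N j by exact: IH.
elim: n {i j} => [|n IH] [|i] [|j] // ijn x xn; try by left; exact: xn.
- by left; exact: iter_sub (@osc_derivative_sub _ _ f e) (leq0n n.+1) _ xn.
- by right; exact: iter_sub (@osc_derivative_sub _ _ f e) (leq0n n.+1) _ xn.
have IHp : iter n (osc_derivative f e) A `<=` P i `|` N j.+1.
  by apply: IH; case: ijn.
have IHn : iter n (osc_derivative f e) A `<=` N j `|` P i.+1.
  by rewrite setUC; apply: IH; case: ijn; rewrite addnS.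
have [|nP] := pselect (P i.+1 x); first by left.
have [|nN] := pselect (N j.+1 x); first by right.
have clP k : closed (P k) by exact: iter_signed_derivative_closed.
have clN k : closed (N k) by exact: iter_signed_derivative_closed.
have [xp|xn'] := osc_derivative_sign xn.
  by left; exact: signed_derivative_cover IHp (clN _) xp nN.
by right; exact: signed_derivative_cover IHn (clP _) xn' nP.
Qed.

(** If x is not of some positive order i, then, being of order i + k, it must be
    of negative order k. *)
Lemma iter_osc_derivative_one_sign e A x : closed A ->
  (forall n, iter n (osc_derivative f e) A x) ->
  (forall k, iter k (signed_derivative fp e) A x) \/
  (forall k, iter k (signed_derivative fn e) A x).
Proof.
move=> Acl xA.
have [|/existsNP[i ni]] := pselect (forall k, iter k (signed_derivative fp e) A x).
  by left.
right=> k; have [|//] := iter_osc_derivative_sign (i := i) (j := k) Acl (xA (i + k)%N).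
by move=> /ni.
Qed.

Variables (g : nat -> K -> R) (M : set nat).
Hypothesis g_continuous : forall n, continuous (g n).
Hypothesis F_M : F M.

(** Start at x and, for each term n of a tuple, move to a nearby point with one
    order less, where g_n >= e. By continuity the earlier functions remain
    almost >= e. A point of order k allows this for k steps. *)
Lemma signed_derivative_subsequence e A U x :
  (forall k, iter k (signed_derivative g e) A x) -> nbhs x U ->
  exists l : nat -> nat, [/\ {homo l : i j / (i < j)%N}, range l `<=` M &
    forall k s, increasing_from k k s -> exists t,
      [/\ U t, A t & forall i, i \in s -> e - k.+1%:R^-1 <= g (l i) t]].
Proof.
move=> xA xU.
pose G k (s : seq nat) := (size s <= k)%N -> exists y,
  [/\ U° y, iter (k - size s) (signed_derivative g e) A y &
     forall n, n \in s -> e - k.+1%:R^-1 < g n y].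
have [||||l [lh lM lG]] := @diagonal_subsequence F M G _ _ _.
- exact: F_M.
- exact: F_tail.
- by move=> k _; exists x; split.
- move=> k s Gs; have [sk|ks] := ltnP (size s) k; last first.
    by apply: nearW => n; rewrite /G size_rcons ltnNge ks.
  have [y [Uy yk ys]] := Gs (ltnW sk).
  move: yk; rewrite -subnSK // iterS => -[Ay yD].
  have yV : nbhs y (U° `&` [set z | forall n, n \in s -> e - k.+1%:R^-1 < g n z]).
    apply: filterI; last exact: near_lt_all.
    by apply: open_nbhs_nbhs; split => //; exact: open_interior.
  apply: filterS (yD _ yV) => n [z [[Uz zs] zk zn]] _.
  exists z; rewrite size_rcons; split => // i.
  rewrite mem_rcons inE => /orP[/eqP->|]; last exact: zs.
  by apply: lt_le_trans zn; rewrite ltrBlDr ltrDl invr_gt0.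
exists l; split=> // k s [ss ks sk].
have [|t [Ut tA ts]] := lG k s ss ks; first by rewrite size_map sk.
exists t; split; first exact: interior_subset.
  by move: tA; rewrite size_map sk subnn.
by move=> i si; apply/ltW/ts/map_f.
Qed.

End SignedDerivative.

Lemma sum_ge_size (R : realType) (I : eqType) (s : seq I) (u : I -> R) c :
  (forall i, i \in s -> c <= u i) -> (size s)%:R * c <= \sum_(i <- s) u i.
Proof.
elim: s => [|i s IH] cu; first by rewrite mul0r big_nil.
rewrite big_cons /= -natr1 mulrDl mul1r addrC lerD //.
  by apply: cu; rewrite inE eqxx.
by apply: IH => j js; apply: cu; rewrite inE js orbT.
Qed.

Section Main.
Context {R : realType} {K : metricType R}.
Hypothesis K_compact : compact [set: K].
Variable f : nat -> continuousType K R.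
Hypothesis f_null : weakly_null f.

(** Given a neighborhood of x and an infinite set M, an ultrafilter containing M
    fixes a sign, and then a sequence in M on which all the averages over tuples
    are large at some point, all terms of the tuple having that sign there. *)
Lemma osc_omega_SP_derivative (e : R) (A B : set K) x : closed A -> A `<=` B ->
  (forall n, iter n (osc_derivative f e) A x) -> SP_derivative f e B x.
Proof.
move=> Acl AB xA; split=> [|U xU M Minf]; first exact/AB/(xA 0%N).
have [F [FU FM Ftail]] := infinite_ultrafilter Minf.
have [C fC] := weakly_null_bounded K_compact f_null.
have fc n : continuous (f n) by exact: cts_fun.
have [xp|xn] := iter_osc_derivative_one_sign FU Ftail K_compact f_null Acl xA.
  have [l [lh lM lP]] := signed_derivative_subsequence FU Ftail fc FM xp xU.
  exists l; split => //; apply: (le_l1SP fC) => k s ks.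
  have [t [Ut At ts]] := lP k s ks; exists t; first by split => //; exact: AB.
  by apply: le_trans (ler_norm _); have := sum_ge_size ts; case: ks => _ _ ->.
have nfc n : continuous (fun t => - f n t) by move=> t; apply: cvgN; exact: fc.
have [l [lh lM lP]] := signed_derivative_subsequence FU Ftail nfc FM xn xU.
exists l; split => //; apply: (le_l1SP fC) => k s ks.
have [t [Ut At ts]] := lP k s ks; exists t; first by split => //; exact: AB.
rewrite -normrN -sumrN; apply: le_trans (ler_norm _).
by have := sum_ge_size ts; case: ks => _ _ ->.
Qed.

Lemma osc_set_SP_set (e : R) b : osc_set f e (omul oomega b) `<=` SP_set f e b.
Proof.
elim: b => X h IH x xb y.
apply: (osc_omega_SP_derivative _ (IH y)) => [|n].
  by apply: derived_closed => A; exact: osc_derivative_closed.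
apply: derived_omega_sub; first exact: osc_derivative_sub.
apply: derived_anti xb; first exact: osc_derivative_sub.
exact: (le_osupremum _ y).
Qed.

Lemma SP_set_osc_set (e e' : R) a :
  0 < e' -> e' < e -> SP_set f e a `<=` osc_set f e' a.
Proof.
move=> e'0 e'e; elim: a => X h IH x xa y.
exact: SP_derivative_osc (IH y) _ (xa y).
Qed.

Lemma compact_metric_second_countable : [set: K] !=set0 -> @second_countable K.
Proof.
move=> [x0 _].
pose pK : pseudoPMetricType R := HB.pack (K : Type) (isPointed.Build K x0) (PseudoMetric.on K).
exact: (@compact_second_countable R pK K_compact).
Qed.

Lemma osc_index_largest (e : R) : 0 < e -> [set: K] !=set0 ->
  is_largest [set a | osc_set f e a !=set0] (osc_index f e).
Proof.
move=> e0 K0; apply: derived_largest => //.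
- exact: compact_metric_second_countable.
- exact: osc_derivative_sub.
- by move=> A; exact: osc_derivative_closed.
- by move=> A; exact: osc_derivative_strict.
Qed.

(** The spreading model derivation has no fixed points either, since its step is
    contained in the oscillation step for e / 2. *)
Lemma SP_index_largest (e : R) : 0 < e -> [set: K] !=set0 ->
  is_largest [set a | SP_set f e a !=set0] (SP_index f e).
Proof.
move=> e0 K0; apply: derived_largest => //.
- exact: compact_metric_second_countable.
- exact: SP_derivative_sub.
- by move=> A; exact: SP_derivative_closed.
- have e20 : 0 < e / 2 by rewrite divr_gt0.
  have e2e : e / 2 < e by rewrite ltr_pdivrMr // ltr_pMr // ltr1n.
  move=> A Acl A0 DA; apply: (osc_derivative_strict K_compact f_null e20 Acl A0).
  apply/seteqP; split; first exact: osc_derivative_sub.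
  rewrite -{1}DA; exact: SP_derivative_osc.
Qed.
End Main.

Lemma olargest_empty (T : Type) (A : ord -> set T) : ~ ([set: T] !=set0) ->
  olargest [set a | A a !=set0] = ozero.
Proof.
move=> T0; rewrite /olargest; case: xgetP => // b _ [[t _] _].
by case: T0; exists t.
Qed.

Theorem corollary3p8 (R : realType) (K : metricType R)
  (K_compact : compact [set: K])
  (f : nat -> continuousType K R) (f_null : weakly_null f)
  (eps : R) (eps_gt0 : 0 < eps) (a : ord) (a_countable : ocountable a) :
  (ole a (SP_index f eps) ->
     forall eps' : R, 0 < eps' -> eps' < eps -> ole a (osc_index f eps')) /\
  (ole (oomega_exp (oadd oone a)) (osc_index f eps) ->
     ole (oomega_exp a) (SP_index f eps)).
Proof.
have [K0|K0] := pselect ([set: K] !=set0); last first.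
  (* For empty K both indices are 0. *)
  split=> [|]; first rewrite /SP_index olargest_empty // => a0 eps' _ _.
    exact: ole_trans a0 (ole0 _).
  rewrite /osc_index olargest_empty // => /(ole_trans (oomega_exp_ge1 _)).
  by move=> /ole_succ/olt_irr.
split=> [aS eps' eps'0 eps'eps|aO].
  have [[t St] _] := SP_index_largest K_compact f_null eps_gt0 K0.
  apply: (osc_index_largest K_compact f_null eps'0 K0).2; exists t.
  apply: (SP_set_osc_set K_compact f_null eps'0 eps'eps).
  exact: (derived_anti (@SP_derivative_sub _ _ f eps) aS St).
have [[t Ot] _] := osc_index_largest K_compact f_null eps_gt0 K0.
apply: (SP_index_largest K_compact f_null eps_gt0 K0).2; exists t.
apply: (osc_set_SP_set K_compact f_null).
apply: (derived_anti (@osc_derivative_sub _ _ f eps) _ Ot).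
exact: ole_trans (omul_omega_exp a) aO.
Qed.
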